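(* Let $X$ be an infinite-dimensional real Banach space and let $(x_n)_{n=1}^\infty$ be a normalized sequence in $X$ (i.e. $\|x_n\|_X=1$ for all $n$). The following conditions are equivalent. 1) $(x_n)_{n=1}^\infty$ is equivalent to the standard unit vector basis of $\ell_1$. 2) There exists $\delta>0$ such that $(x_n)_{n=1}^\infty$ is uniformly equivalent to any $\delta$-dominated perturbation of itself; that is, there exist $\delta>0$ and functions $K_1,K_2:[0,\delta)\to(0,\infty)$ such that, for every sequence $(y_n)_{n=1}^\infty$ in $X$ with $m:=\sup_{n\in\mathbb N}\|x_n-y_n\|_X<\delta$, the sequence $(x_n)_{n=1}^\infty$ is $(K_1(m),K_2(m))$-equivalent to $(y_n)_{n=1}^\infty$. 3) There exists $\delta>0$ such that $(x_n)_{n=1}^\infty$ is equivalent to every $\delta$-dominated perturbation of itself. 4) $\ell_1$ is isomorphically embedded in $X$ (i.e. $X$ has a closed subspace linearly homeomorphic to $\ell_1$), and there exists $\delta>0$ such that $(x_n)_{n=1}^\infty$ is equivalent to every $\delta$-dominated perturbation of itself.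
   Context: $\ell_1$ is the real Banach space of absolutely summable real sequences. For positive numbers $K_1,K_2$, a sequence $(x_n)$ in a Banach space $X$ is $(K_1,K_2)$-equivalent to a sequence $(y_n)$ in a Banach space $Y$ if, for every finite sequence of real scalars $(\alpha_n)_{n=1}^m$, $$K_1\Big\|\sum_{n=1}^m\alpha_n y_n\Big\|_Y\le\Big\|\sum_{n=1}^m\alpha_nx_n\Big\|_X\le K_2\Big\|\sum_{n=1}^m\alpha_ny_n\Big\|_Y .$$ The sequence $(x_n)$ is equivalent to $(y_n)$ if it is $(K_1,K_2)$-equivalent to $(y_n)$ for some positive $K_1,K_2$. A sequence $(y_n)$ in $X$ is a $\delta$-dominated perturbation of a sequence $(x_n)$ in $X$ if $\sup_{n\in\mathbb N}\|x_n-y_n\|_X<\delta$. No sequence here is assumed in advance to be basic. *)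

(* Defs.v *)
From HB Require Import structures.
From mathcomp Require Import all_boot all_order all_algebra.
From mathcomp Require Import all_classical all_reals all_analysis.

Set Implicit Arguments.
Unset Strict Implicit.
Unset Printing Implicit Defensive.

Import Order.TTheory GRing.Theory Num.Theory.
Import numFieldNormedType.Exports.

Local Open Scope classical_set_scope.
Local Open Scope ring_scope.

Section ell1.
Context {R : realType}.
Implicit Types (x y : R^nat) (c : R).

Definition abs_summable : {pred R^nat} :=
  [pred x : R^nat | `[< cvgn [normed series x] >]].

Lemma abs_summableP x : reflect (cvgn [normed series x]) (x \in abs_summable).
Proof. exact: asboolP. Qed.

Lemma abs_summable_ub x (M : R) :
  (forall n, [normed series x] n <= M) -> x \in abs_summable.
Proof.
move=> xM; apply/abs_summableP; apply: nondecreasing_is_cvgn.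
  by apply: nondecreasing_series => i _ _; exact: normr_ge0.
by exists M => _ [n _ <-].
Qed.

Lemma abs_summable_le x n : x \in abs_summable ->
  [normed series x] n <= limn [normed series x].
Proof.
move=> /abs_summableP cx; apply: nondecreasing_cvgn_le => //.
by apply: nondecreasing_series => i _ _; exact: normr_ge0.
Qed.

Lemma abs_summable_submod : submod_closed abs_summable.
Proof.
split.
  apply: (@abs_summable_ub _ 0) => n.
  by rewrite /= /series /= big1// => i _; rewrite normr0.
move=> c x y sx sy.
pose l (z : R^nat) := limn [normed series z].
apply: (@abs_summable_ub _ (`|c| * l x + l y)) => n.
apply: (@le_trans _ _
  (`|c| * [normed series x] n + [normed series y] n)); last first.
  by rewrite lerD ?ler_wpM2l ?abs_summable_le.
rewrite /= /series /= mulr_sumr -big_split /=; apply: ler_sum => i _.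
by rewrite (le_trans (ler_normD _ _))// normrM.
Qed.

HB.instance Definition _ :=
  GRing.isSubmodClosed.Build R (R^nat) abs_summable abs_summable_submod.

Record ell1 := Ell1 { ell1_seq :> nat -> R; _ : ell1_seq \in abs_summable }.

HB.instance Definition _ := [isSub for ell1_seq].
HB.instance Definition _ := [Choice of ell1 by <:].
HB.instance Definition _ := [SubChoice_isSubLmodule of ell1 by <:].

Lemma ell1_summable (u : ell1) : (u : R^nat) \in abs_summable.
Proof. by case: u. Qed.

Definition ell1_norm (u : ell1) : R := limn [normed series u].

Lemma ell1_norm_le (u : ell1) n : [normed series u] n <= ell1_norm u.
Proof. exact/abs_summable_le/ell1_summable. Qed.

Lemma ell1_norm_ub (u : ell1) (M : R) :
  (forall n, [normed series u] n <= M) -> ell1_norm u <= M.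
Proof.
move=> uM; apply: limr_le; first exact/abs_summableP/ell1_summable.
by near=> n; apply: uM.
Unshelve. all: by end_near. Qed.

Lemma ell1_normD (u v : ell1) : ell1_norm (u + v) <= ell1_norm u + ell1_norm v.
Proof.
apply: ell1_norm_ub => n.
apply: (@le_trans _ _ ([normed series u] n + [normed series v] n)); last first.
  by rewrite lerD ?ell1_norm_le.
rewrite /= /series /= -big_split /=; apply: ler_sum => i _.
exact: ler_normD.
Qed.

Lemma ell1_normZ c (u : ell1) : ell1_norm (c *: u) = `|c| * ell1_norm u.
Proof.
have cu : cvgn [normed series u] by exact/abs_summableP/ell1_summable.
rewrite /ell1_norm -[RHS]limZr//; congr (lim (_ @ \oo)).
apply/funext => n; rewrite /= /series /= [RHS]mulr_sumr.
by apply: eq_bigr => i _; rewrite normrM.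
Qed.

Lemma ell1_norm_coord (u : ell1) n : `|u n| <= ell1_norm u.
Proof.
apply: le_trans (ell1_norm_le u n.+1).
by rewrite /= /series /= big_nat_recr //= lerDr sumr_ge0.
Qed.

Lemma ell1_norm0_eq0 (u : ell1) : ell1_norm u = 0 -> u = 0.
Proof.
move=> u0; apply/val_inj/funext => n /=.
by apply/eqP; rewrite -normr_le0 -u0 ell1_norm_coord.
Qed.

HB.instance Definition _ :=
  Lmodule_isNormed.Build R ell1 ell1_normD ell1_normZ ell1_norm0_eq0.

Lemma unit_vector_summable n :
  ((fun k => (k == n)%:R) : R^nat) \in abs_summable.
Proof.
apply: (@abs_summable_ub _ 1) => m.
rewrite /= /series /=; elim: m n => [|m IH] n; first by rewrite big_geq.
rewrite big_nat_recl //=; case: n => [|n] /=.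
  by rewrite normr1 big1 ?addr0// => i _; rewrite normr0.
rewrite normr0 add0r; exact: IH.
Qed.

Definition ell1_unit n : ell1 := Ell1 (unit_vector_summable n).

Lemma ell1_complete (F : set_system ell1) :
  ProperFilter F -> cauchy F -> cvg F.
Proof.
move=> FF /cauchyP Fc.
have Fcoord n : cvg ((fun v : ell1 => v n) @ F).
  apply: R_complete; apply/cauchyP => e e0.
  have [u Fu] := Fc _ e0; exists (u n).
  change (F [set v : ell1 | ball (u n) e (v n)]).
  apply: filterS Fu => v; rewrite -!ball_normE /=.
  by apply: le_lt_trans; exact: (ell1_norm_coord (u - v) n).
pose f : R^nat := fun n => lim ((fun v : ell1 => v n) @ F).
have approx (u : ell1) (e : R) : F (ball u e) ->
    forall n, [normed series ((u : R^nat) - f)] n <= e.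
  move=> Fu n.
  have cvS : (fun v : ell1 => [normed series ((u : R^nat) - (v : R^nat))] n) @ F
      --> [normed series ((u : R^nat) - f)] n.
    rewrite /= /series /=; apply: cvg_big => [|i _]; first exact: add_continuous.
    apply: cvg_norm.
    by apply: cvgB; [exact: cvg_cst | exact: Fcoord].
  rewrite -(cvg_lim _ cvS)//; apply: limr_le; first exact: cvgP cvS.
  apply: filterS Fu => v; rewrite -ball_normE /= => /ltW; apply: le_trans.
  exact: (ell1_norm_le (u - v) n).
have sf : f \in abs_summable.
  have [u Fu] := Fc _ ltr01.
  rewrite -[f](subKr (u : R^nat)); apply: rpredB; first exact: ell1_summable.
  exact/abs_summable_ub/(approx _ _ Fu).
apply/cvg_ex; exists (Ell1 sf); apply/cvgrPdist_le => e e0.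
have e20 : 0 < e / 2 by rewrite divr_gt0.
have [u Fu] := Fc _ e20; apply: filterS (Fu) => v.
rewrite -ball_normE /= => /ltW uv.
rewrite -(subrKA u) [leRHS]splitr (le_trans (ler_normD _ _))// lerD//.
rewrite distrC; exact: (@ell1_norm_ub (u - Ell1 sf) _ (approx _ _ Fu)).
Qed.

HB.instance Definition _ := Uniform_isComplete.Build ell1 ell1_complete.

End ell1.

Arguments ell1 R : clear implicits.

Section equivalence.
Context {R : realType}.

Definition equivalent_with (X Y : normedModType R) (K1 K2 : R)
    (x : nat -> X) (y : nat -> Y) : Prop :=
  forall (m : nat) (a : 'I_m -> R),
    K1 * `|\sum_(n < m) a n *: y n| <= `|\sum_(n < m) a n *: x n|
      <= K2 * `|\sum_(n < m) a n *: y n|.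

Definition equivalent (X Y : normedModType R)
    (x : nat -> X) (y : nat -> Y) : Prop :=
  exists K1 K2 : R, [/\ 0 < K1, 0 < K2 & equivalent_with K1 K2 x y].

(* The supremum is taken in the extended reals: it is +oo when the differences
   are unbounded. *)
Definition sup_dist (X : normedModType R) (x y : nat -> X) : \bar R :=
  ereal_sup (range (fun n => (`|x n - y n|)%:E)).

Definition dominated_perturbation (X : normedModType R) (delta : R)
    (x y : nat -> X) : Prop :=
  (sup_dist x y < delta%:E)%E.

Definition infinite_dimensional (X : lmodType R) : Prop :=
  ~ exists (n : nat) (v : 'I_n -> X),
      forall u : X, exists a : 'I_n -> R, u = \sum_(i < n) a i *: v i.

(* The closed subspace of X is the range of f; only the restriction of g to
   that range, which is the inverse of f, matters. *)
Definition isomorphically_embedded (Y X : normedModType R) : Prop :=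
  exists (f : {linear Y -> X}) (g : X -> Y),
    [/\ closed (range f), continuous f, cancel f g
      & {within range f, continuous g}].

End equivalence.

(* Main.v *)
Require Import Defs.
From HB Require Import structures.
From mathcomp Require Import all_boot all_order all_algebra.
From mathcomp Require Import all_classical all_reals all_analysis.
From mathcomp Require Import lra.

Import Order.TTheory GRing.Theory Num.Theory.
Import numFieldNormedType.Exports.

Local Open Scope classical_set_scope.
Local Open Scope ring_scope.

(** For a normalized sequence x, equivalence to the unit vector basis of ell_1
    amounts to a lower estimate A * sum |a_n| <= |sum a_n x_n| over all finite
    families of scalars, with A > 0 (lemma equivalent_ell1_unitP); the upper
    estimate is the triangle inequality.

    A lower estimate with constant A is stable: moving each x_n by at most
    s < A changes sum a_n x_n by at most s * sum |a_n| <= (s / A) *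
    |sum a_n x_n|, so x is (A / (A + s), A / (A - s))-equivalent to the moved
    sequence (lemma equivalent_with_perturb). These constants depend only on
    the distance s, which is uniform equivalence.

    Conversely, let x be equivalent to all its delta-dominated perturbations,
    and move it in a single direction: y_n = x_n + (delta / 2) e_n x_0 with
    |e_n| <= 1. The equivalence gives
    |sum a_n e_n| <= C(e) * |sum a_n x_n| for all a. The functionals
    e |-> sum a_n e_n on ell_oo, of norm sum |a_n|, are thus pointwise bounded
    relatively to |sum a_n x_n|, and the uniform boundedness principle makes
    C(e) uniform, which is the lower estimate (lemmas ell1_uniform_bound, by a
    gliding hump, and ell1_lower_of_stable).

    Finally, a lower estimate makes u |-> sum u_n x_n a bounded linear map from
    ell_1 that is bounded below, hence an isomorphism onto a closed subspace
    (lemma lower_ell1_embedding). *)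

(** * A uniform boundedness principle for finitely supported functionals *)

(** The coordinate N of the functionals is tested on the indicator of N; only
    N coordinates are involved in the sum. *)
Lemma sum_head_bound (R : realType) (I : Type) (m : I -> nat)
    (a : I -> nat -> R) (p : I -> R) :
  (forall e : nat -> R, (forall n, `|e n| <= 1) ->
     exists C, forall i, `|\sum_(n < m i) a i n * e n| <= C * p i) ->
  forall N, exists C, forall i,
    \sum_(n < m i | (n < N)%N) `|a i n| <= C * p i.
Proof.
move=> bd; elim=> [|N [C hC]].
  by exists 0 => i; rewrite big_pred0_eq mul0r.
have [n|D hD] := bd (fun n => (n == N)%:R).
  by case: eqP; rewrite ?normr1 ?normr0.
exists (C + D) => i; rewrite mulrDl.
rewrite (bigID (fun n : 'I_(m i) => (n < N)%N)) /=; apply: lerD.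
  apply: le_trans (hC i); rewrite le_eqVlt; apply/orP; left; apply/eqP.
  by apply: eq_bigl => n; rewrite andb_idl// => /leqW.
apply: le_trans (hD i).
under eq_bigl => n do rewrite -leqNgt ltnS andbC -eqn_leq eq_sym.
rewrite (big_ord1_eq _ (fun n => `|a i n|)).
have -> : \sum_(n < m i) a i n * (nat_of_ord n == N)%:R
          = if (N < m i)%N then a i N else 0.
  rewrite -(big_ord1_eq +%R (fun n => a i n)) [RHS]big_mkcond.
  by apply: eq_bigr => n _; rewrite mulr_natr mulrb.
by case: ifP; rewrite ?normr0.
Qed.

(** The functionals e |-> sum_n a i n * e n on the unit ball of ell_oo, if
    pointwise bounded relatively to p, are bounded in norm relatively to p. *)
Lemma ell1_uniform_bound (R : realType) (I : Type) (m : I -> nat)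
    (a : I -> nat -> R) (p : I -> R) :
  (forall i, 0 <= p i) ->
  (forall e : nat -> R, (forall n, `|e n| <= 1) ->
     exists C, forall i, `|\sum_(n < m i) a i n * e n| <= C * p i) ->
  exists2 C, 0 < C & forall i, \sum_(n < m i) `|a i n| <= C * p i.
Proof.
move=> p0 bd; have [h hP] := choice (sum_head_bound R I m a p bd).
have [[N [C hC]]|humps] := pselect (exists N C, forall i,
    \sum_(n < m i | (N <= n)%N) `|a i n| <= C * p i).
  (* If some tail is bounded, it is enough to add the bound of the head. *)
  exists (`|h N + C| + 1) => [|i]; first by rewrite ltr_wpDl.
  rewrite (bigID (fun n : 'I_(m i) => (n < N)%N)) /=.
  under [X in _ + X]eq_bigl => n do rewrite -leqNgt.
  apply: (le_trans (lerD (hP N i) (hC i))); rewrite -mulrDl.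
  apply: ler_wpM2r => //; rewrite (le_trans (ler_norm _))//.
  by rewrite lerDl.
(* No tail is bounded: for any N and k, some functional has beyond N a mass
   exceeding k * p plus the bound of its head below N. *)
exfalso.
have hump (q : nat * nat) : exists i,
    (q.2%:R + h q.1) * p i < \sum_(n < m i | (q.1 <= n)%N) `|a i n|.
  apply/not_existsP => H; apply: humps; exists q.1, (q.2%:R + h q.1) => i.
  by rewrite leNgt; exact/negP/H.
have [pick pickP] := choice hump.
(* Consecutive humps: the k-th functional, j k, has its hump on the block
   [t k, t k.+1), where t k.+1 is the length of that functional. *)
pose t := fix t k := if k is k'.+1 then m (pick (t k', k')) else 0%N.
pose j k := pick (t k, k).
have h0 k : 0 <= h (t k) * p (j k) by apply: le_trans (hP _ _); exact: sumr_ge0.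
have t_lt k : (t k < t k.+1)%N.
  rewrite ltnNge; apply/negP => le_t; have := pickP (t k, k); rewrite /= -/(j k).
  rewrite big_pred0 => [|n]; last first.
    by apply/negbTE; rewrite -ltnNge (leq_trans (ltn_ord n)).
  by rewrite ltNge mulrDl addr_ge0// mulr_ge0.
have t_mono k l : (k <= l)%N -> (t k <= t l)%N.
  apply: (homo_leq (r := leq)) => // [? ? ?|i]; first exact: leq_trans.
  exact: ltnW.
have t_cofinal n : exists k, (n < t k.+1)%N.
  by exists n; elim: n => [|n IH]; [exact: t_lt|exact: leq_ltn_trans (t_lt _)].
pose block n := ex_minn (t_cofinal n).
have blockE k n : (t k <= n)%N -> (n < t k.+1)%N -> block n = k.
  move=> tn nt; rewrite /block; case: ex_minnP => l nl /(_ _ nt) lk.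
  apply/eqP; rewrite eqn_leq lk /= leqNgt; apply/negP => l_lt.
  by have := leq_trans nl (t_mono _ _ l_lt); rewrite ltnNge tn.
(* The test sequence has on each block the signs of the hump located there. *)
have [n|C hC] := bd (fun n => Num.sg (a (j (block n)) n)).
  by rewrite normr_sg lern1 leq_b1.
have := hC (j (Num.trunc C).+1).
set k := (Num.trunc C).+1; rewrite leNgt => /negP; apply.
apply: (@le_lt_trans _ _ (k%:R * p (j k))).
  by apply: ler_wpM2r => //; exact/ltW/truncnS_gt.
rewrite (bigID (fun n : 'I_(m (j k)) => (n < t k)%N)) /= addrC.
under eq_bigl => n do rewrite -leqNgt.
under eq_bigr => n tn do
  rewrite (blockE k n tn (ltn_ord n)) mulrC -normrEsg.
set T := \sum_(n < _ | (t k <= n)%N) _; set H := \sum_(n < _ | _) _.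
(* Below t k, the sum is at most the bound of the head, that is, at most the
   part of the hump that exceeds k * p. *)
have HT : `|H| <= h (t k) * p (j k).
  apply: le_trans (hP _ _); apply: (le_trans (ler_norm_sum _ _ _)).
  apply: ler_sum => n _; rewrite normrM normr_sg -[leRHS]mulr1.
  by rewrite ler_wpM2l// lern1 leq_b1.
have TT : (k%:R + h (t k)) * p (j k) < T by exact: (pickP (t k, k)).
apply: (@lt_le_trans _ _ (T - `|H|)).
  by rewrite ltrBrDr (le_lt_trans _ TT)// mulrDl lerD2l.
by rewrite lerBlDr (le_trans (ler_norm _))// -[in leLHS](addrK H T) ler_normB.
Qed.

(** * Equivalence to the unit vector basis of ell_1 *)

Lemma ell1_unit_norm_le1 (R : realType) n : `|ell1_unit (R:=R) n| <= 1.
Proof.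
apply: ell1_norm_ub => m; rewrite /= /series /=.
under eq_bigr => k _ do rewrite normr_nat mulrb.
by rewrite -big_mkcond big_nat1_eq; case: ifP.
Qed.

Lemma ell1_sum_coord (R : realType) m (a : 'I_m -> R) (k : 'I_m) :
  (\sum_(n < m) a n *: ell1_unit n : ell1 R) k = a k.
Proof.
have sumE (r : seq 'I_m) : (\sum_(n <- r) a n *: ell1_unit n : ell1 R) k
    = \sum_(n <- r) a n * (k == n)%:R.
  by elim: r => [|n r IH]; rewrite ?big_nil// !big_cons -IH.
rewrite sumE (bigD1 k)//= eqxx mulr1 big1 ?addr0// => n.
by rewrite eq_sym => /negbTE ->; rewrite mulr0.
Qed.

Lemma ell1_unit_comb_norm (R : realType) m (a : 'I_m -> R) :
  `|\sum_(n < m) a n *: ell1_unit n : ell1 R| = \sum_(n < m) `|a n|.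
Proof.
apply/eqP; rewrite eq_le; apply/andP; split.
  apply: (le_trans (ler_norm_sum _ _ _)); apply: ler_sum => n _.
  by rewrite normrZ -[leRHS]mulr1 ler_wpM2l// ell1_unit_norm_le1.
have := ell1_norm_le (\sum_(n < m) a n *: ell1_unit n) m.
rewrite /= /series /= big_mkord; apply: le_trans; apply: ler_sum => n _.
by rewrite ell1_sum_coord.
Qed.

Lemma equivalent_ell1_unitP (R : realType) (X : normedModType R)
    (x : nat -> X) :
  (forall n, `|x n| <= 1) ->
  (equivalent x (@ell1_unit R) <->
   exists2 A : R, 0 < A & forall m (a : 'I_m -> R),
     A * \sum_(n < m) `|a n| <= `|\sum_(n < m) a n *: x n|).
Proof.
move=> x1; split=> [[A [B [A0 _ AB]]]|[A A0 hA]].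
  by exists A => // m a; have /andP[] := AB m a; rewrite ell1_unit_comb_norm.
exists A, 1; split=> // m a; rewrite ell1_unit_comb_norm hA /= mul1r.
apply: (le_trans (ler_norm_sum _ _ _)); apply: ler_sum => n _.
by rewrite normrZ -[leRHS]mulr1 ler_wpM2l.
Qed.

(** * Embedding of ell_1 *)

(** The series sum_n u_n x_n. It is the default value of the limit if the
    series diverges, which cannot happen for x bounded and X complete. *)
Definition ell1_synthesis (R : realType) (X : normedModType R) (x : nat -> X)
  (u : ell1 R) : X := limn (series (fun n => u n *: x n)).

Lemma synthesis_cvg (R : realType) (X : completeNormedModType R)
    (x : nat -> X) (x1 : forall n, `|x n| <= 1) (u : ell1 R) :
  cvgn (series (fun n => u n *: x n)).
Proof.
apply: normed_cvg; apply: nondecreasing_is_cvgn.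
  by apply: nondecreasing_series => i _ _; exact: normr_ge0.
exists `|u| => _ [n _ <-]; apply: le_trans (ell1_norm_le u n).
rewrite /= /series /=; apply: ler_sum => i _.
by rewrite normrZ -[leRHS]mulr1 ler_wpM2l.
Qed.

Lemma synthesis_linear (R : realType) (X : completeNormedModType R)
    (x : nat -> X) (x1 : forall n, `|x n| <= 1) : linear (ell1_synthesis R X x).
Proof.
move=> c u v; apply: cvg_lim; first exact: norm_hausdorff.
have -> : series (fun n => (c *: u + v) n *: x n)
  = (fun k => c *: series (fun n => u n *: x n) k
              + series (fun n => v n *: x n) k).
  apply/funext => k; rewrite /series /= scaler_sumr -big_split /=.
  by apply: eq_bigr => i _; rewrite scalerA -scalerDl.
by apply: cvgD; [apply: cvgZl_tmp|]; exact: synthesis_cvg.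
Qed.

Lemma synthesis_norm_le (R : realType) (X : completeNormedModType R)
    (x : nat -> X) (x1 : forall n, `|x n| <= 1) (u : ell1 R) :
  `|ell1_synthesis R X x u| <= `|u|.
Proof.
have cu : `|series (fun n => u n *: x n) n| @[n --> \oo]
    --> `|ell1_synthesis R X x u|.
  by apply: cvg_norm; exact: synthesis_cvg.
rewrite -(cvg_lim (@norm_hausdorff _ _) cu); apply: limr_le.
  exact: cvgP cu.
apply: nearW => n; apply: le_trans (ell1_norm_le u n).
apply: (le_trans (ler_norm_sum _ _ _)); rewrite /= /series /=.
by apply: ler_sum => i _; rewrite normrZ -[leRHS]mulr1 ler_wpM2l.
Qed.

Lemma synthesis_norm_ge (R : realType) (X : completeNormedModType R)
    (x : nat -> X) (x1 : forall n, `|x n| <= 1) (A : R) :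
  (forall m (a : 'I_m -> R),
     A * \sum_(n < m) `|a n| <= `|\sum_(n < m) a n *: x n|) ->
  forall u : ell1 R, A * `|u| <= `|ell1_synthesis R X x u|.
Proof.
move=> lower u.
have cu : [normed series u] n @[n --> \oo] --> `|u|.
  exact/abs_summableP/ell1_summable.
apply: (ler_cvg_to (a := \oo) (f := fun n => A * [normed series u] n)
  (g := fun n => `|series (fun n => u n *: x n) n|)).
- by apply: cvgMl_tmp; exact: cu.
- by apply: cvg_norm; exact: synthesis_cvg.
- by apply: nearW => n; rewrite /= /series /= !big_mkord; exact: lower.
Qed.

(** The inverse is Lipschitz on the range: a filter on the range that converges
    in X is therefore mapped to a Cauchy filter of Y, whose limit has for image
    the limit of the former, so that the range is closed. *)
Lemma bounded_below_embedding (R : realType) (Y : completeNormedModType R)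
    (X : normedModType R) (f : {linear Y -> X}) (A : R) :
  0 < A -> continuous f -> (forall u, A * `|u| <= `|f u|) ->
  isomorphically_embedded Y X.
Proof.
move=> A0 cf lower.
have dist_le u v : `|u - v| <= A^-1 * `|f u - f v|.
  by rewrite -linearB ler_pdivlMl.
have f_inj : injective f.
  move=> u v fuv; apply/eqP; rewrite -subr_eq0 -normr_le0.
  by rewrite (le_trans (dist_le u v))// fuv subrr normr0 mulr0.
pose g := 'pinv_(fun=> 0) setT f.
have fgK : cancel f g.
  by move=> u; apply: pinvKV; rewrite ?inE// => ? ? _ _; exact: f_inj.
exists f, g; split => //.
- move=> z cl_z; pose G := within (range f) (nbhs z).
  have GG : ProperFilter G by exact: within_nbhs_proper.
  have Grange : G (range f) by exact: withinT.
  have : cauchy (g @ G).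
    apply/cauchyP => e e0.
    have d0 : 0 < A * e / 2 by rewrite divr_gt0 ?mulr_gt0.
    have Gz : G (ball z (A * e / 2))
      by apply: (@cvg_within _ (nbhs z) _ (range f)); exact: nbhsx_ballx.
    have [w [zu [u _ fu]]] := filter_ex (filterI Gz Grange).
    move: zu; rewrite -fu -ball_normE /= => zu; exists u.
    apply: (@filterS _ G _ (ball z (A * e / 2) `&` range f)); last exact: filterI.
    move=> w' [zv [v _ fv]]; move: zv; rewrite -fv -!ball_normE /= fgK => zv.
    apply: (le_lt_trans (dist_le u v)); rewrite ltr_pdivrMl// [ltRHS]splitr.
    by rewrite -(subrKA z) (le_lt_trans (ler_normD _ _))// ltrD// distrC.
  move=> /cauchy_cvg /cvg_ex[u gu]; exists u => //.
  have fgu : f (g w) @[w --> G] --> f u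
    by apply: continuous_cvg => //; exact: cf.
  apply: (@cvg_unique _ _ (f (g w) @[w --> G])) fgu _.
    exact: norm_hausdorff.
  apply: (@cvg_trans _ (w @[w --> G])); last exact: cvg_within.
  apply: near_eq_cvg.
  by apply: filterS Grange => _ [v _ <-] /=; rewrite fgK.
- apply/subspace_continuousP => _ [u _ <-].
  change (g w @[w --> within (range f) (nbhs (f u))] --> g (f u)); rewrite fgK.
  apply/cvgrPdist_lt => e e0.
  have : within (range f) (nbhs (f u)) (ball (f u) (A * e)).
    apply: (@cvg_within _ (nbhs (f u)) _ (range f)).
    by apply: nbhsx_ballx; exact: mulr_gt0.
  move=> /(filterI (withinT (F := nbhs (f u)) (range f) _)).
  apply: filterS => w [[v _ <-]]; rewrite -ball_normE /= fgK => uv.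
  by rewrite (le_lt_trans (dist_le u v))// ltr_pdivrMl.
Qed.

Lemma lower_ell1_embedding (R : realType) (X : completeNormedModType R)
    (x : nat -> X) (A : R) :
  0 < A -> (forall n, `|x n| <= 1) ->
  (forall m (a : 'I_m -> R),
     A * \sum_(n < m) `|a n| <= `|\sum_(n < m) a n *: x n|) ->
  isomorphically_embedded (ell1 R) X.
Proof.
move=> A0 x1 lower.
pose L := GRing.isLinear.Build R (ell1 R) X _ (ell1_synthesis R X x)
  (synthesis_linear R X x x1).
pose f : {linear ell1 R -> X} := HB.pack (ell1_synthesis R X x) L.
apply: (bounded_below_embedding R (ell1 R) X f A) => // [|u]; last first.
  exact: synthesis_norm_ge.
apply/linear_bounded_continuous/linear_boundedP; near=> r => u.
apply: (le_trans (synthesis_norm_le R X x x1 u)).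
by rewrite -[leLHS]mul1r ler_wpM2r//; near: r; exact: nbhs_pinfty_ge.
Unshelve. all: by end_near. Qed.

(** * Dominated perturbations *)

Lemma sup_dist_ub (R : realType) (X : normedModType R) (x y : nat -> X)
    (n : nat) : ((`|x n - y n|)%:E <= sup_dist x y)%E.
Proof. by apply: ereal_sup_ubound; exists n. Qed.

Lemma sup_dist_le (R : realType) (X : normedModType R) (x y : nat -> X)
    (d : R) : (forall n, `|x n - y n| <= d) -> (sup_dist x y <= d%:E)%E.
Proof. by move=> xy; apply: ge_ereal_sup => _ [n _ <-]; rewrite lee_fin. Qed.

Lemma dominated_perturbation_sup (R : realType) (X : normedModType R)
    (delta : R) (x y : nat -> X) :
  dominated_perturbation delta x y ->
  0 <= fine (sup_dist x y) < delta /\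
  forall n, `|x n - y n| <= fine (sup_dist x y).
Proof.
rewrite /dominated_perturbation => xy.
have := fun n => sup_dist_ub R X x y n; case: (sup_dist x y) xy => [s| |] //=.
  rewrite lte_fin => -> xys; split=> [|n]; last by have := xys n; rewrite lee_fin.
  by have := xys 0%N; rewrite andbT lee_fin; apply: le_trans.
by move=> _ /(_ 0%N).
Qed.

(** The perturbations used are x_n + (delta / 2) e_n x_0 with |e_n| <= 1. *)
Lemma ell1_lower_of_stable (R : realType) (X : normedModType R)
    (x : nat -> X) (hx : forall n, `|x n| = 1) (delta : R) :
  0 < delta ->
  (forall y, dominated_perturbation delta x y -> equivalent x y) ->
  exists2 A : R, 0 < A & forall m (a : 'I_m -> R),
    A * \sum_(n < m) `|a n| <= `|\sum_(n < m) a n *: x n|.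
Proof.
move=> d0 stable; have d20 : 0 < delta / 2 by rewrite divr_gt0.
(* The functionals are indexed by the finite families of scalars: a length and
   a sequence, of which only the terms below that length matter. *)
pose I := {m : nat & nat -> R}.
pose p (i : I) := `|\sum_(n < projT1 i) projT2 i n *: x n|.
have [||C C0 hC] := ell1_uniform_bound R I (fun i => projT1 i)
    (fun i => projT2 i) p.
- by move=> i; exact: normr_ge0.
- move=> e e1; pose y n := x n + (delta / 2 * e n) *: x 0%N.
  have /stable[K1 [K2 [K10 _ K]]] : dominated_perturbation delta x y.
    apply: (@le_lt_trans _ _ (delta / 2)%:E); last first.
      by rewrite lte_fin ltr_pdivrMr// ltr_pMr// ltr1n.
    apply: sup_dist_le => n; rewrite opprD addNKr normrN normrZ hx mulr1 normrM.
    by rewrite gtr0_norm// -[leRHS]mulr1 ler_wpM2l// ltW.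
  exists ((delta / 2)^-1 * (K1^-1 + 1)) => -[m a]; rewrite /p /= -mulrA.
  rewrite ler_pdivlMl// -[X in X * _](gtr0_norm d20) -normrM mulr_sumr.
  have [+ _] := andP (K m (fun n => a n)); rewrite -ler_pdivlMl// => hK.
  have -> : \sum_(n < m) delta / 2 * (a n * e n)
      = \sum_(n < m) a n * (delta / 2 * e n).
    by apply: eq_bigr => n _; rewrite mulrCA.
  rewrite -[leLHS]mulr1 -[X in _ * X <= _](hx 0%N) -normrZ scaler_suml.
  rewrite mulrDl mul1r.
  have -> : \sum_(n < m) (a n * (delta / 2 * e n)) *: x 0%N
      = \sum_(n < m) a n *: y n - \sum_(n < m) a n *: x n.
    rewrite -sumrB; apply: eq_bigr => n _.
    by rewrite /y scalerDr addrAC subrr add0r scalerA.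
  by apply: (le_trans (ler_normB _ _)); rewrite lerD2r.
exists C^-1; first by rewrite invr_gt0.
(* The family a extended by 0. *)
move=> m a; pose b n := oapp a 0 (insub n).
have bE (n : 'I_m) : b n = a n by rewrite /b valK.
rewrite ler_pdivrMl//; have := hC (existT _ m b); rewrite /p /=.
by under eq_bigr do rewrite bE; under [in leRHS]eq_bigr do rewrite bE.
Qed.

(** The lower estimate absorbs the perturbation:
    |sum a_n (x_n - y_n)| <= s * sum |a_n| <= (s / A) * |sum a_n x_n|. *)
Lemma equivalent_with_perturb (R : realType) (X : normedModType R)
    (x y : nat -> X) (A s : R) :
  0 <= s < A -> (forall n, `|x n - y n| <= s) ->
  (forall m (a : 'I_m -> R),
     A * \sum_(n < m) `|a n| <= `|\sum_(n < m) a n *: x n|) ->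
  equivalent_with (A / (A + s)) (A / (A - s)) x y.
Proof.
move=> /andP[s0 sA] xy lower m a; have A0 := le_lt_trans s0 sA.
set sx := \sum_(n < m) a n *: x n; set sy := \sum_(n < m) a n *: y n.
have dist_le : A * `|sx - sy| <= s * `|sx|.
  apply: le_trans (ler_wpM2l s0 (lower m a)).
  rewrite [leRHS]mulrCA ler_wpM2l ?(ltW A0)// -sumrB mulr_sumr.
  apply: (le_trans (ler_norm_sum _ _ _)).
  by apply: ler_sum => n _; rewrite -scalerBr normrZ mulrC ler_wpM2r.
have sy_le : A * `|sy| <= A * `|sx| + A * `|sx - sy|.
  by rewrite -mulrDr ler_wpM2l ?(ltW A0)// -[sy in leLHS](subKr sx) ler_normB.
have sx_le : A * `|sx| <= A * `|sx - sy| + A * `|sy|.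
  by rewrite -mulrDr ler_wpM2l ?(ltW A0)// -[sx in leLHS](subrK sy) ler_normD.
rewrite mulrAC ler_pdivrMr ?ltr_pwDl// mulrAC ler_pdivlMr ?subr_gt0//.
by apply/andP; split; lra.
Qed.

Theorem theorem1 (R : realType) (X : completeNormedModType R)
  (hX : infinite_dimensional X) (x : nat -> X) (hx : forall n, `|x n| = 1) :
  [<->
    (* 1 *) equivalent x (@ell1_unit R);
    (* 2 *) exists2 delta : R, 0 < delta &
              exists K1 K2 : R -> R,
                (forall t, 0 <= t < delta -> 0 < K1 t /\ 0 < K2 t) /\
                (forall y : nat -> X, dominated_perturbation delta x y ->
                   let m := fine (sup_dist x y) in
                   equivalent_with (K1 m) (K2 m) x y);
    (* 3 *) exists2 delta : R, 0 < delta &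
              forall y : nat -> X, dominated_perturbation delta x y ->
                equivalent x y;
    (* 4 *) isomorphically_embedded (ell1 R) X /\
            exists2 delta : R, 0 < delta &
              forall y : nat -> X, dominated_perturbation delta x y ->
                equivalent x y].
Proof.
have x1 n : `|x n| <= 1 by rewrite hx.
have ell1P := equivalent_ell1_unitP R X x x1.
tfae.
- move=> /ell1P[A A0 lower]; exists A => //.
  exists (fun t => A / (A + t)), (fun t => A / (A - t)); split.
    by move=> t /andP[t0 tA]; rewrite !divr_gt0 ?subr_gt0 ?ltr_pwDl.
  move=> y /dominated_perturbation_sup[sA xy] m.
  exact: equivalent_with_perturb.
- move=> [delta d0 [K1 [K2 [K0 K]]]]; exists delta => // y xy.
  have [/K0[K10 K20] _] := dominated_perturbation_sup R X delta x y xy.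
  by exists (K1 (fine (sup_dist x y))), (K2 (fine (sup_dist x y))); split=> //;
    exact: K.
- move=> [delta d0 stable]; split; last by exists delta.
  have [A A0 lower] := ell1_lower_of_stable R X x hx delta d0 stable.
  exact: lower_ell1_embedding A0 x1 lower.
- move=> [_ [delta d0 stable]]; apply/ell1P.
  exact: ell1_lower_of_stable hx delta d0 stable.
Qed.
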